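(* Let $p$ be any pattern with $d$ distinct letters and let $k \geq d-1$ be given. Then there is a constant $C>0$ such that $$|[k]^n(p)| \simeq C\,n^M(d-1)^n \qquad (n \rightarrow \infty),$$ where $M+1$ is the maximum number of states with $d-1$ loops in a simple path in the automaton $\mathcal{A}(p,k)$ (the maximum being taken over all simple paths).
   Context: Here $k$ is a positive integer and $[k]=\{1,\dots,k\}$; $[k]^*$ is the set of finite words (including the empty word $\epsilon$) over $[k]$ and $[k]^n$ the set of words of length $n$. A pattern is a word $p=p_1\cdots p_r$ of positive integers. A word $w=w_1\cdots w_s$ contains $p$ if there are $1\le t_1<\cdots<t_r\le s$ such that for all $1\le i,j\le r$: $w_{t_i}\le w_{t_j}$ if and only if $p_i\le p_j$; otherwise $w$ avoids $p$. $[k]^n(p)$ is the set of words in $[k]^n$ that avoid $p$. For $v,w\in[k]^*$ write $v\sim_p w$ if for all $r\in[k]^*$: $vr$ avoids $p$ if and only if $wr$ avoids $p$. Let $\langle w\rangle$ be the equivalence class of $w$ and $\mathcal{E}(p,k)$ the (finite) set of classes. The class of all words that contain $p$ is denoted $\langle p\rangle$; it is counted as a state, and if no word of $[k]^*$ contains $p$ it is regarded as a formal state not reachable from the other states. The automaton $\mathcal{A}(p,k)$ is identified with the directed multigraph with vertices (states) $\mathcal{E}(p,k)$, in which for each state $\langle v\rangle$ and each $i\in[k]$ there is an edge labelled $i$ from $\langle v\rangle$ to $\langle vi\rangle$. A loop at a state is an edge from the state to itself (loops with different labels are different). A path in $\mathcal{A}(p,k)$ is called simple if it starts at $\langle\epsilon\rangle$,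 does not use any loops, and does not end in $\langle p\rangle$. For real sequences, $a_n\simeq b_n$ means $\lim_{n\to\infty} a_n/b_n=1$. *)

(* Defs.v *)
From mathcomp Require Import all_boot all_order all_algebra.
From mathcomp Require Import all_classical all_reals all_analysis.
Import numFieldNormedType.Exports.

Set Implicit Arguments.
Unset Strict Implicit.
Unset Printing Implicit Defensive.

Local Open Scope classical_set_scope.

(* The alphabet {1, ..., k} is represented by 'I_k = {0, ..., k - 1}: only the
   order of the letters matters for containment. *)
Notation word k := (seq 'I_k).

(* A pattern is a nonempty sequence of positive natural numbers. *)
Definition is_pattern (p : seq nat) : bool :=
  (p != [::]) && all (fun a => 0 < a) p.

Definition contains (p : seq nat) (k : nat) (w : word k) : bool :=
  [exists t : {ffun 'I_(size p) -> 'I_(size w)},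
     [forall i : 'I_(size p), forall j : 'I_(size p), (i < j) ==> (t i < t j)] &&
     [forall i : 'I_(size p), forall j : 'I_(size p),
        (tnth (in_tuple w) (t i) <= tnth (in_tuple w) (t j)) ==
        (tnth (in_tuple p) i <= tnth (in_tuple p) j)]].

Definition avoids (p : seq nat) (k : nat) (w : word k) : bool :=
  ~~ contains p w.

Definition num_avoiding (p : seq nat) (k n : nat) : nat :=
  #|[pred w : n.-tuple 'I_k | avoids p w]|.

Definition word_equiv (p : seq nat) (k : nat) (v w : word k) : Prop :=
  forall r : word k, avoids p (v ++ r) <-> avoids p (w ++ r).

Definition word_class (p : seq nat) (k : nat) (v : word k) : set (word k) :=
  [set w | word_equiv p v w].

(* If no word over the alphabet contains p, this is the empty set, which is not
   the class of any word: it is then the formal, unreachable state. *)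
Definition pattern_class (p : seq nat) (k : nat) : set (word k) :=
  [set w | contains p w].
Arguments pattern_class p k : clear implicits.

Definition states (p : seq nat) (k : nat) : set (set (word k)) :=
  [set S | (exists v, S = word_class p v) \/ S = pattern_class p k].
Arguments states p k : clear implicits.

Definition edge (p : seq nat) (k : nat)
    (S : set (word k)) (i : 'I_k) (T : set (word k)) : Prop :=
  [/\ states p k S, states p k T &
      exists v, S = word_class p v /\ T = word_class p (rcons v i)].

Definition num_loops (p : seq nat) (k : nat) (S : set (word k)) : nat :=
  #|[pred i : 'I_k | `[< edge p S i S >]]|.

(* A path from S is encoded by the list of its successive edges, each edge being
   given by its label and its target. *)
Fixpoint is_path (p : seq nat) (k : nat) (S : set (word k))
    (e : seq ('I_k * set (word k))) : Prop :=
  if e is (i, T) :: e' then edge p S i T /\ is_path p T e' else True.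

Fixpoint loop_free (k : nat) (S : set (word k))
    (e : seq ('I_k * set (word k))) : Prop :=
  if e is (_, T) :: e' then S <> T /\ loop_free T e' else True.

Definition path_states (k : nat) (S : set (word k))
    (e : seq ('I_k * set (word k))) : seq (set (word k)) :=
  S :: unzip2 e.

Definition simple_path (p : seq nat) (k : nat)
    (e : seq ('I_k * set (word k))) : Prop :=
  let S0 := word_class p [::] in
  [/\ is_path p S0 e, loop_free S0 e &
      last S0 (unzip2 e) <> pattern_class p k].

Definition num_states_with_loops (p : seq nat) (k l : nat)
    (e : seq ('I_k * set (word k))) : nat :=
  size (undup [seq S <- path_states (word_class p [::]) e
              | num_loops p S == l]).

Definition max_states_with_loops (p : seq nat) (k l m : nat) : Prop :=
  (exists2 e : seq ('I_k * set (word k)),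
     simple_path p e & num_states_with_loops p l e = m) /\
  (forall e : seq ('I_k * set (word k)),
     simple_path p e -> num_states_with_loops p l e <= m).

Local Open Scope ring_scope.

(* a n / b n --> 1, where the quotient 0 / 0 is read as 1 (it is 0 in MathComp).
   This matters only for sequences b with infinitely many zeros, such as
   b n = 0 ^+ n. *)
Definition asymp_equiv (R : realType) (a b : nat -> R) : Prop :=
  (if (a n == 0) && (b n == 0) then 1 else a n / b n) @[n --> \oo] --> (1 : R).

(* Main.v *)
Require Import Defs.
From mathcomp Require Import all_boot all_order all_algebra.
From mathcomp Require Import all_classical all_reals all_analysis.
From mathcomp Require Import ring lra zify.
Import numFieldNormedType.Exports.
Import Order.TTheory GRing.Theory Num.Theory.

(** Let [q = d - 1].  Extending a word can only enlarge the set of its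
subsequences of length at most [size p], and this set determines the class of
the word; hence a path of the automaton that leaves a state never returns to it,
so that apart from its loops the automaton is acyclic, and every path without
loops has bounded length ([word_equiv_cat_inv], [missing_subwords_lt]).

A state whose words avoid [p] has at most [q] loops: if the letters of a set [A]
with [d] elements all were loops at the class of [v], then [v] would be
equivalent to all its extensions by words over [A], one of which contains [p]
([num_loops_lt]).  Conversely a word over an alphabet of [q] letters avoids [p];
reading such letters as long as they change the state leads to a state at which
they are all loops ([full_state_exists]).  So the maximum is at least 1.

Let [f v n] be the number of words [r] of length [n] such that [v ++ r] avoids
[p].  Sorting the extensions by their first letter gives
[f v n.+1 = l * f v n + \sum_i f (rcons v i) n], where [l] is the number of
loops at [v] and [i] runs over the letters that leave the class of [v] for a
class other than that of the words containing [p] ([num_ext_step]).  After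
division by [q ^ n], a vertex with [l = q] sums the contributions of its
successors, which raises the order of growth by one, while a vertex with [l < q]
acts as a contraction, which keeps it.  Hence [f v n] grows like
[n ^ (m - 1) * q ^ n], where [m] is the maximal number of states with [q] loops
on a simple path from [v], provided that [m > 0], by induction along the acyclic
automaton ([growth_vertex], [vertex_growth]).  The one delicate point is that nothing in
this induction excludes [m = 0] for a state other than the initial one, and then
[f v n / q ^ n] would tend to 0 at an unknown rate; the induction therefore
controls the partial sums of [f v n / q ^ n], which converge in that case and
grow like [n ^ m] in general.

If [q = 0] then no state avoiding [p] has a loop, so long words contain [p] and
both sequences vanish eventually. *)

Set Implicit Arguments.
Unset Strict Implicit.
Unset Printing Implicit Defensive.

Local Open Scope classical_set_scope.

(** * Occurrences of a pattern as subsequences *)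

Definition order_iso (p q : seq nat) : Prop :=
  size q = size p /\
  forall i j, i < size p -> j < size p ->
    (nth 0 q i <= nth 0 q j) = (nth 0 p i <= nth 0 p j).

Lemma sorted_enum_ord_ltn n : sorted (fun i j : 'I_n => i < j) (enum 'I_n).
Proof.
have := iota_ltn_sorted 0 n; rewrite -val_enum_ord.
by rewrite sorted_map.
Qed.

Lemma ord_sorted_subseq n (s t : seq 'I_n) :
  sorted (fun i j : 'I_n => i < j) s -> sorted (fun i j : 'I_n => i < j) t ->
  {subset s <= t} -> subseq s t.
Proof.
move=> ss st sub.
have tr : transitive (fun i j : 'I_n => i < j) by move=> x y z; exact: ltn_trans.
have -> : s = [seq x <- t | x \in s]; last exact: filter_subseq.
apply: (irr_sorted_eq tr) => //; first by move=> x /=; rewrite ltnn.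
  exact: sorted_filter.
move=> x; rewrite mem_filter; case: (boolP (x \in s)) => //= /sub ->//.
Qed.

Lemma size_undup_gt0 (T : eqType) (s : seq T) : s != [::] -> 0 < size (undup s).
Proof.
case: s => // a s _; rewrite -has_predT; apply/hasP; exists a => //.
by rewrite mem_undup mem_head.
Qed.

Section Words.
Variables (p : seq nat) (k : nat).
Implicit Types (u v w r x y : word k) (i : 'I_k).

(** Occurrences given by words instead of positions are easy to split along a
concatenation; this is the form of containment used from here on. *)
Lemma containsP w :
  reflect (exists2 u, subseq u w & order_iso p (map val u)) (contains p w).
Proof.
apply: (iffP existsP) => [[t /andP[tm tp]]|[u /subseqP[m sm ->] [szu hu]]].
  pose g (a : 'I_(size p)) := tnth (in_tuple w) (t a).
  have nthg (a : 'I_(size p)) : nth 0 (map val (map g (enum 'I_(size p)))) a = g a.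
    rewrite -map_comp (nth_map a) ?size_enum_ord //.
    by rewrite (nth_ord_enum a).
  exists (map g (enum 'I_(size p))).
    rewrite -[X in subseq _ X](map_tnth_enum (in_tuple w)).
    rewrite (_ : g = tnth (in_tuple w) \o t) // map_comp.
    apply: map_subseq; apply: ord_sorted_subseq.
    - rewrite sorted_map; apply: sub_sorted (sorted_enum_ord_ltn _) => a b /=.
      by move=> ab; have /forallP/(_ a)/forallP/(_ b)/implyP := tm; apply.
    - exact: sorted_enum_ord_ltn.
    - by move=> a _; rewrite mem_enum.
  split; first by rewrite !size_map -enumT size_enum_ord.
  move=> i j hi hj; rewrite (nthg (Ordinal hi)) (nthg (Ordinal hj)).
  have /forallP/(_ (Ordinal hi))/forallP/(_ (Ordinal hj))/eqP := tp.
  by rewrite /g !(tnth_nth 0).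
set s := mask m (enum 'I_(size w)).
have es : mask m w = map (tnth (in_tuple w)) s.
  by rewrite /s map_mask map_tnth_enum.
have ss : sorted (fun i j : 'I_(size w) => i < j) s.
  apply: subseq_sorted (sorted_enum_ord_ltn _); last exact: mask_subseq.
  by move=> a b c; exact: ltn_trans.
have szs : size s == size p by rewrite -szu es !size_map.
pose T := Tuple szs.
have nthT (a : 'I_(size p)) :
    nth 0 (map val (mask m w)) a = tnth (in_tuple w) (tnth T a).
  rewrite es -map_comp (nth_map (tnth T a)) ?(eqP szs) //=.
  by congr (val (tnth _ _)); rewrite [RHS](tnth_nth (tnth T a)).
exists [ffun a => tnth T a]; apply/andP; split.
  apply/forallP => a; apply/forallP => b; apply/implyP => ab; rewrite !ffunE.
  rewrite [tnth T b](tnth_nth (tnth T a)).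
  rewrite [X in nat_of_ord X < _](tnth_nth (tnth T a)).
  have tr : transitive (fun i j : 'I_(size w) => i < j).
    by move=> x y z; exact: ltn_trans.
  have := sorted_ltn_nth tr (tnth T a) ss; by apply=> //; rewrite inE (eqP szs).
apply/forallP => a; apply/forallP => b; rewrite !ffunE -!nthT hu //.
by rewrite !(tnth_nth 0).
Qed.

Lemma contains_subseq v w : subseq v w -> contains p v -> contains p w.
Proof.
move=> vw /containsP[u uv iu]; apply/containsP; exists u => //.
exact: subseq_trans vw.
Qed.

Lemma avoids_subseq v w : subseq v w -> avoids p w -> avoids p v.
Proof. by move=> vw; apply: contraNN; exact: contains_subseq. Qed.

Lemma subseq_cat_split (T : eqType) (u v w : seq T) : subseq u (v ++ w) ->
  exists a b, [/\ u = a ++ b, subseq a v & subseq b w].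
Proof.
move=> /subseqP[m sm ->].
exists (mask (take (size v) m) v), (mask (drop (size v) m) w); split.
- rewrite -mask_cat ?cat_take_drop // size_take sm size_cat.
  by case: ltnP => //; rewrite -[leqRHS]addn0 leq_add2l leqn0 => /eqP ->; rewrite addn0.
- exact: mask_subseq.
- exact: mask_subseq.
Qed.

(** * Equivalence of words *)

Lemma word_equiv_refl v : word_equiv p v v.
Proof. by []. Qed.

Lemma word_equiv_sym v w : word_equiv p v w -> word_equiv p w v.
Proof. by move=> h r; split=> /h. Qed.

Lemma word_equiv_trans v w x :
  word_equiv p v w -> word_equiv p w x -> word_equiv p v x.
Proof. by move=> h h' r; split=> [/h/h'//|/h'/h]. Qed.

Lemma word_equiv_cat v w x : word_equiv p v w -> word_equiv p (v ++ x) (w ++ x).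
Proof. by move=> h r; rewrite -!catA. Qed.

Lemma word_equiv_rcons v w i :
  word_equiv p v w -> word_equiv p (rcons v i) (rcons w i).
Proof. by rewrite -!cats1; exact: word_equiv_cat. Qed.

Lemma word_equiv_avoids v w : word_equiv p v w -> avoids p v = avoids p w.
Proof. by move=> /(_ [::]); rewrite !cats0 => h; apply/idP/idP => /h. Qed.

(** Acyclicity up to loops: once a class has been left, it is not reached again,
because the set of continuations that create an occurrence of [p] only grows. *)
Lemma word_equiv_cat_inv v x y :
  word_equiv p v ((v ++ x) ++ y) -> word_equiv p v (v ++ x).
Proof.
move=> h r; split=> [/h|].
  by apply: avoids_subseq; rewrite -!catA !subseq_cat2l suffix_subseq.
by apply: avoids_subseq; rewrite -!catA subseq_cat2l suffix_subseq.
Qed.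

(** An occurrence of [p] in [v ++ r] splits into a subsequence of [v] and one of
[r], and the former has length at most [size p]. *)
Lemma same_short_subseqs v w :
  (forall u, size u <= size p -> subseq u v = subseq u w) -> word_equiv p v w.
Proof.
have half x y : (forall u, size u <= size p -> subseq u x -> subseq u y) ->
    forall r, contains p (x ++ r) -> contains p (y ++ r).
  move=> h r /containsP[u /subseq_cat_split[u1 [u2 [-> h1 h2]]] iu].
  apply/containsP; exists (u1 ++ u2) => //; apply: cat_subseq => //; apply: h => //.
  by case: iu; rewrite size_map size_cat => <- _; exact: leq_addr.
move=> h r; split; apply: contraNN; apply: half => u su; by rewrite (h u su).
Qed.

(** A measure that drops whenever the class changes; in particular it bounds the
number of class changes along any word. *)
Definition missing_subwords v := #|[pred u : (size p).-bseq 'I_k | ~~ subseq u v]|.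

Lemma missing_subwords_lt v w : subseq v w -> ~ word_equiv p v w ->
  missing_subwords w < missing_subwords v.
Proof.
move=> vw nvw; apply: proper_card; apply/properP; split.
  apply/fintype.subsetP => u; rewrite !inE; apply: contraNN => uv.
  exact: subseq_trans vw.
apply: contrapT => h; apply: nvw; apply: same_short_subseqs => u su.
apply/idP/idP => [uv|uw]; first exact: subseq_trans vw.
apply/negPn/negP => uv; apply: h; exists (Bseq su); rewrite !inE //=.
by rewrite uw.
Qed.

Lemma missing_subwords_rcons v i : ~ word_equiv p v (rcons v i) ->
  missing_subwords (rcons v i) < missing_subwords v.
Proof. by apply: missing_subwords_lt; exact: subseq_rcons. Qed.

(** * States, edges and loops *)

Lemma word_classP v w : word_class p v = word_class p w <-> word_equiv p v w.
Proof.
split=> [h|h].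
  have : word_class p w w by exact: word_equiv_refl.
  by rewrite -h.
apply/seteqP; split=> x hx.
  exact: word_equiv_trans (word_equiv_sym h) hx.
exact: word_equiv_trans h hx.
Qed.

(** Containing [p] persists under extension, so that the words containing [p] are
all equivalent. *)
Lemma word_class_pattern v : word_class p v = pattern_class p k <-> contains p v.
Proof.
split=> [h|cv].
  have : word_class p v v by exact: word_equiv_refl.
  by rewrite h.
apply/seteqP; split=> w /=.
  by move=> /word_equiv_avoids/negb_inj h; rewrite /pattern_class /= -h.
move=> cw r; rewrite /avoids (contains_subseq (prefix_subseq v r)) //.
by rewrite (contains_subseq (prefix_subseq w r)).
Qed.

Lemma edgeE v i T : edge p (word_class p v) i T <-> T = word_class p (rcons v i).
Proof.
split=> [[_ _ [w [/word_classP h ->]]]|->].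
  by apply/esym/word_classP; exact: word_equiv_rcons.
by split; [left; exists v|left; exists (rcons v i)|exists v].
Qed.

Definition is_loop v i : bool := `[< word_equiv p v (rcons v i) >].

Lemma num_loops_class v : num_loops p (word_class p v) = #|is_loop v|.
Proof.
apply: eq_card => i; rewrite !inE /is_loop.
apply/asboolP/asboolP => [/edgeE/word_classP//|h].
by apply/edgeE/word_classP.
Qed.

(** * Letters and loops *)

Lemma count_ltn_lt (s : seq nat) (P : pred nat) a :
  (forall b, b <= a -> P b) -> a \in s -> count (fun b => b < a) s < count P s.
Proof.
move=> hP; elim: s => // b s IH; rewrite inE => /orP[/eqP <-|/IH] /=.
  rewrite ltnn hP // add0n add1n ltnS; apply: sub_count => c /= ca.
  by apply: hP; exact: ltnW.
move=> h; rewrite -addnS leq_add //.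
by case: ltnP => // ba; rewrite hP // ltnW.
Qed.

(** As soon as [A] has as many letters as [p], the letters of [p] embed into [A]
in an order preserving way: send a letter to the letter of [A] of equal rank. *)
Lemma order_iso_over (A : pred 'I_k) : p != [::] -> size (undup p) <= #|A| ->
  exists2 u, all (mem A) u & order_iso p (map val u).
Proof.
move=> p0 dA; have : 0 < #|A| by exact: leq_trans (size_undup_gt0 p0) dA.
case/card_gt0P => x0 _.
(* The rank of a letter among the distinct letters of [p]. *)
pose rk a := count (fun b => b < a) (undup p).
have rk_lt a : a \in p -> rk a < size (enum A).
  move=> ap; rewrite -cardE; apply: leq_trans dA.
  by rewrite -count_predT; apply: count_ltn_lt; rewrite ?mem_undup.
pose phi a := nth x0 (enum A) (rk a).
have sA : sorted (fun i j : 'I_k => i < j) (enum A).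
  have -> : enum A = [seq i <- enum 'I_k | i \in A] by rewrite [in RHS]enumT.
  apply: sorted_filter; last exact: sorted_enum_ord_ltn.
  by move=> a b c; exact: ltn_trans.
have tr : transitive (fun i j : 'I_k => i < j) by move=> a b c; exact: ltn_trans.
have phi_mono : {in p &, {mono (fun a => val (phi a)) : a b / a <= b}}.
  apply: leq_mono_in => a b ap bp ab.
  have := sorted_ltn_nth tr x0 sA; apply; rewrite ?inE ?rk_lt //.
  by apply: count_ltn_lt; rewrite ?mem_undup // => c; rewrite -ltnS => /leq_trans; apply.
exists (map phi p).
  apply/allP => i /mapP[a ap ->] /=; rewrite -mem_enum; apply: mem_nth.
  exact: rk_lt.
split; first by rewrite !size_map.
move=> i j hi hj; rewrite -map_comp !(nth_map 0) //=.
by apply: phi_mono; exact: mem_nth.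
Qed.

(** An occurrence of [p] uses as many distinct letters as [p] has: reading off the
letter of [p] below each letter of the occurrence covers all letters of [p]. *)
Lemma avoids_few (A : pred 'I_k) w :
  all (mem A) w -> #|A| < size (undup p) -> avoids p w.
Proof.
move=> wA; rewrite ltnNge; apply: contraNN => /containsP[u uw [szu iu]].
rewrite size_map in szu.
(* The letter of [p] in the position where [u] first has the letter [i]. *)
pose g i := nth 0 p (index i u).
rewrite cardE -(size_map g); apply: uniq_leq_size; first exact: undup_uniq.
move=> b; rewrite mem_undup => bp.
have hi : index b p < size p by rewrite index_mem.
have hiu : index b p < size u by rewrite szu.
have [i0 _] : exists i : 'I_k, i \in u.
  by case: (u) hiu => // c ? _; exists c; rewrite mem_head.
pose a := nth i0 u (index b p).
have au : a \in u by exact: mem_nth.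
apply/mapP; exists a.
  by rewrite mem_enum; have /allP := wA; apply; exact: (mem_subseq uw).
have hj : index a u < size p by rewrite -szu index_mem.
rewrite /g -{1}(nth_index 0 bp); apply/eqP; rewrite eqn_leq -!iu //.
by rewrite !(nth_map i0) ?szu // nth_index // leqnn.
Qed.

Lemma loops_cat v u : all (is_loop v) u -> word_equiv p v (v ++ u).
Proof.
elim/last_ind: u => [|u i IH]; first by rewrite cats0.
rewrite all_rcons => /andP[/asboolP hi /IH h]; rewrite -rcons_cat.
exact: word_equiv_trans hi (word_equiv_rcons i h).
Qed.

(** Reading loops does not change the class, yet with as many loops as [p] has
letters one can read an occurrence of [p]. *)
Lemma num_loops_lt v : p != [::] -> avoids p v -> #|is_loop v| < size (undup p).
Proof.
move=> p0 av; rewrite ltnNge; apply/negP => /(order_iso_over p0)[u hu iu].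
have hl : all (is_loop v) u by apply/allP => i iu'; have /allP/(_ i iu') := hu.
move: av; rewrite (word_equiv_avoids (loops_cat hl)); apply/negP.
by apply/negPn/containsP; exists u => //; exact: suffix_subseq.
Qed.

End Words.

(** * Numbers of avoiding extensions *)

Section Counting.
Variables (p : seq nat) (k : nat).
Implicit Types (u v w r x y : word k) (i : 'I_k).

Definition num_ext v n := #|[pred r : n.-tuple 'I_k | avoids p (v ++ r)]|.

Lemma num_ext0 v : avoids p v -> num_ext v 0 = 1.
Proof.
move=> av; transitivity #|{: 0.-tuple 'I_k}|; last by rewrite card_tuple.
by apply: eq_card => t; rewrite !inE tuple0 cats0 av.
Qed.

Lemma num_extS v n : num_ext v n.+1 = \sum_i num_ext (rcons v i) n.
Proof.
rewrite /num_ext -sum1_card.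
rewrite (reindex (fun ir : 'I_k * n.-tuple 'I_k => cons_tuple ir.1 ir.2)) /=.
  rewrite -(pair_big_dep xpredT
    (fun i (r : n.-tuple 'I_k) => avoids p (v ++ i :: r)) (fun _ _ => 1)) /=.
  apply: eq_bigr => i _; rewrite -sum1_card; apply: eq_bigl => r.
  by rewrite inE cat_rcons.
exists (fun t : n.+1.-tuple 'I_k => (thead t, behead_tuple t)) => [[i r] _|t _] /=.
  by congr pair; apply: val_inj.
by rewrite [t in RHS]tuple_eta; apply: val_inj.
Qed.

Lemma num_ext_contains v n : contains p v -> num_ext v n = 0.
Proof.
move=> cv; apply: eq_card0 => r; rewrite !inE; apply/negbTE/negPn.
exact: contains_subseq (prefix_subseq _ _) cv.
Qed.

Lemma num_ext_equiv v w n : word_equiv p v w -> num_ext v n = num_ext w n.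
Proof. by move=> h; apply: eq_card => r; rewrite !inE; apply/idP/idP => /h. Qed.

Definition exits v : pred 'I_k :=
  fun i => ~~ is_loop p v i && avoids p (rcons v i).

Lemma num_ext_step v n :
  num_ext v n.+1 = #|is_loop p v| * num_ext v n
                   + \sum_(i | exits v i) num_ext (rcons v i) n.
Proof.
rewrite num_extS (bigID (is_loop p v)) /=; congr (_ + _).
  rewrite -sum_nat_const; apply: eq_bigr => i /asboolP h.
  exact/esym/num_ext_equiv.
rewrite (bigID (fun i => avoids p (rcons v i))) /= [X in _ + X]big1 ?addn0 //.
by move=> i /andP[_ /negPn]; exact: num_ext_contains.
Qed.

(** When [p] has a single letter there are no loops outside the class of words
containing [p], so that every letter read decreases the measure. *)
Lemma num_ext_loopless v n : p != [::] -> size (undup p) = 1 ->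
  missing_subwords p v < n -> num_ext v n = 0.
Proof.
move=> p0 d1; elim: n v => // n IH v hn.
have [av|/negPn] := boolP (avoids p v); last exact: num_ext_contains.
have := num_loops_lt p0 av; rewrite d1 ltnS leqn0 => /eqP l0.
rewrite num_ext_step l0 mul0n add0n big1 // => i /andP[/asboolPn nl _].
by apply: IH; apply: leq_trans (missing_subwords_rcons nl) _.
Qed.

End Counting.

(** * Simple paths *)

Section Paths.
Variables (p : seq nat) (k l : nat).
Implicit Types (u v w r x y : word k) (i : 'I_k) (e : seq ('I_k * set (word k))).

(** The simple paths of the statement, started at an arbitrary class: this is what
makes an induction along the automaton possible. *)
Definition simple_from v e : Prop :=
  [/\ is_path p (word_class p v) e, loop_free (word_class p v) e &
      last (word_class p v) (unzip2 e) <> pattern_class p k].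

Definition num_states_from (S : set (word k)) e : nat :=
  size (undup [seq T <- path_states S e | num_loops p T == l]).

Definition max_from v m : Prop :=
  (exists2 e, simple_from v e & num_states_from (word_class p v) e = m) /\
  (forall e, simple_from v e -> num_states_from (word_class p v) e <= m).

Lemma path_states_extend v e T : is_path p (word_class p v) e ->
  T \in path_states (word_class p v) e -> exists x, T = word_class p (v ++ x).
Proof.
elim: e v => [|[i S] e IH] v.
  by rewrite /path_states /= inE => _ /eqP ->; exists [::]; rewrite cats0.
rewrite /path_states /= => -[/edgeE -> hp]; rewrite inE => /orP[/eqP ->|hT].
  by exists [::]; rewrite cats0.
by have [x ->] := IH _ hp hT; exists (i :: x); rewrite cat_rcons.
Qed.

Lemma simple_from_avoids v e : simple_from v e -> avoids p v.
Proof.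
move=> [hp _ hl]; apply/negP => cv; apply: hl.
have hT : last (word_class p v) (unzip2 e) \in path_states (word_class p v) e.
  by rewrite /path_states mem_last.
have [x ->] := path_states_extend hp hT.
by apply/word_class_pattern; exact: contains_subseq (prefix_subseq _ _) cv.
Qed.

Lemma simple_from_nil v : avoids p v -> simple_from v [::].
Proof. by move=> av; split => //= /word_class_pattern; exact/negP. Qed.

Lemma num_states_from_nil v :
  num_states_from (word_class p v) [::] = (#|is_loop p v| == l).
Proof. by rewrite /num_states_from /= num_loops_class; case: eqP. Qed.

(** The first state does not occur again on the path, hence removing duplicates
does not affect its contribution. *)
Lemma num_states_from_cons v i e : ~ word_equiv p v (rcons v i) ->
  is_path p (word_class p (rcons v i)) e ->
  num_states_from (word_class p v) ((i, word_class p (rcons v i)) :: e) =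
    (#|is_loop p v| == l) + num_states_from (word_class p (rcons v i)) e.
Proof.
move=> nl hp.
have hS : word_class p v \notin path_states (word_class p (rcons v i)) e.
  apply/negP => /(path_states_extend hp)[x /word_classP].
  by rewrite -cats1 => /word_equiv_cat_inv; rewrite cats1.
rewrite /num_states_from -[path_states (word_class p v) _]/
  (word_class p v :: path_states (word_class p (rcons v i)) e).
move: (path_states _ e) hS => s hS /=; rewrite num_loops_class.
by case: eqP => // _; rewrite add1n /= mem_filter (negbTE hS) andbF.
Qed.

Lemma simple_from_cons v i T e : simple_from v ((i, T) :: e) <->
  [/\ T = word_class p (rcons v i), ~ word_equiv p v (rcons v i) &
      simple_from (rcons v i) e].
Proof.
split=> [[/= [/edgeE -> hp] [nl lf] hl]|[-> nl [hp lf hl]]].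
  by split=> // /word_classP.
split=> //=; first by split => //; apply/edgeE.
by split=> // /word_classP.
Qed.

(** A simple path from [v] is empty or starts with one of the exits of [v]; since
the maximum of an empty family is 0, the formula covers a [v] without exits. *)
Lemma max_from_step v (m : 'I_k -> nat) : avoids p v ->
  (forall i, exits p v i -> max_from (rcons v i) (m i)) ->
  max_from v ((#|is_loop p v| == l) + \max_(i | exits p v i) m i).
Proof.
move=> av hm; split.
  have [/card0_eq e0|] := posnP #|exits p v|.
    exists [::]; first exact: simple_from_nil.
    by rewrite num_states_from_nil big_pred0 // addn0.
  case/(eq_bigmax_cond m) => i hi Mi.
  have [[e he em] _] := hm i hi.
  have /andP[/asboolPn nl _] : exits p v i by [].
  exists ((i, word_class p (rcons v i)) :: e); first exact/simple_from_cons.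
  have [hp _ _] := he.
  by rewrite num_states_from_cons // em; congr (_ + _); exact/esym/Mi.
case=> [_|[i T] e /simple_from_cons[-> nl he]].
  by rewrite num_states_from_nil leq_addr.
have [hp _ _] := he.
have hi : exits p v i.
  by apply/andP; split; [exact/asboolPn|exact: simple_from_avoids he].
rewrite num_states_from_cons // leq_add2l.
by apply: leq_trans (leq_bigmax_cond _ hi); apply: (hm i hi).2.
Qed.

End Paths.

(** * Orders of growth *)

Local Open Scope ring_scope.

Section Growth.
Variable R : realType.
Implicit Types (u v x y : nat -> R) (a : nat) (s t : bool).

(** The scale of growth: [bincoef a n] is asymptotic to [n ^ a / a!].  Unlike for
the powers of [n], the partial sums of one scale are exactly the next one, which
makes summation immediate. *)
Definition bincoef a n : R := 'C(n + a, a)%:R.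

(** The flag [s] records whether the limit is known to be positive.  Keeping the
null limits in the same predicate lets sums mix dominant and negligible
terms. *)
Definition growth u a s :=
  exists2 C : R, (0 <= C) && (s ==> (0 < C)) & (u n / bincoef a n @[n --> \oo] --> C).

Definition psum u n : R := \sum_(j < n.+1) u j.

Lemma bincoef_gt0 a n : 0 < bincoef a n.
Proof. by rewrite ltr0n bin_gt0 leq_addl. Qed.

Lemma bincoef_ge0 a n : 0 <= bincoef a n.
Proof. exact: ler0n. Qed.

Lemma bincoef_neq0 a n : bincoef a n != 0.
Proof. by rewrite gt_eqF ?bincoef_gt0. Qed.

Lemma bincoef0 n : bincoef 0 n = 1.
Proof. by rewrite /bincoef bin0. Qed.

Lemma bincoefS a n : bincoef a.+1 n.+1 = bincoef a.+1 n + bincoef a n.+1.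
Proof. by rewrite /bincoef addnS binS addSnnS natrD. Qed.

Lemma bincoef_n0 a : bincoef a 0 = 1.
Proof. by rewrite /bincoef add0n binn. Qed.

Lemma bincoefSM a n : a.+1%:R * bincoef a.+1 n = (n + a.+1)%:R * bincoef a n.
Proof.
rewrite /bincoef -!natrM; congr _%:R.
by rewrite -mul_bin_diag addnS.
Qed.

Lemma bincoef_ratioM a n : (n.+1 + a)%:R * bincoef a n = n.+1%:R * bincoef a n.+1.
Proof.
rewrite /bincoef -!natrM; congr _%:R.
by have := mul_bin_down (n.+1 + a) a; rewrite addSn /= -addSn addnK.
Qed.

Lemma cvg_invn : (n%:R^-1 : R) @[n --> \oo] --> (0 : R).
Proof. by rewrite -cvg_shiftS; exact: cvg_harmonic. Qed.

Lemma bincoef_ratio a : bincoef a n / bincoef a n.+1 @[n --> \oo] --> (1 : R).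
Proof.
have -> : (fun n => bincoef a n / bincoef a n.+1) = (fun n => (1 + a%:R * harmonic n)^-1).
  apply/funext => n; rewrite /harmonic /=.
  have h := bincoef_ratioM a n; have h1 := bincoef_neq0 a n.+1.
  have h2 : n.+1%:R != 0 :> R by rewrite pnatr_eq0.
  have h3 : (n.+1 + a)%:R != 0 :> R by rewrite pnatr_eq0.
  have -> : bincoef a n = n.+1%:R * bincoef a n.+1 / (n.+1 + a)%:R by rewrite -h; field.
  by move: h3; rewrite natrD => h3; field; rewrite ?nat1r h1 h2 ?h3 -?natrD ?pnatr_eq0.
rewrite -[X in _ --> X]invr1; apply: cvgV; first exact: oner_neq0.
rewrite -[X in _ --> X]addr0; apply: cvgD; first exact: cvg_cst.
rewrite -(mulr0 a%:R); apply: cvgM; [exact: cvg_cst|exact: cvg_harmonic].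
Qed.

Lemma bincoef_pow a : bincoef a n / n%:R ^+ a @[n --> \oo] --> (a`!%:R^-1 : R).
Proof.
elim: a => [|a IH].
  have -> : (fun n => bincoef 0 n / n%:R ^+ 0) = (fun=> 1).
    by apply/funext => n; rewrite bincoef0 expr0 divr1.
  have -> : (0`!%:R^-1 : R) = 1 by rewrite fact0 invr1.
  exact: cvg_cst.
have h : (1 + a.+1%:R / n%:R) * (bincoef a n / n%:R ^+ a) / a.+1%:R @[n --> \oo]
    --> ((1 + a.+1%:R * 0) * a`!%:R^-1 / a.+1%:R : R).
  apply: cvgM; last exact: cvg_cst.
  apply: cvgM => //; apply: cvgD; first exact: cvg_cst.
  by apply: cvgM; [exact: cvg_cst|exact: cvg_invn].
have -> : (a.+1`!%:R^-1 : R) = (1 + a.+1%:R * 0) * a`!%:R^-1 / a.+1%:R.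
  by rewrite mulr0 addr0 mul1r factS natrM invfM mulrC.
apply: cvg_trans h; apply: near_eq_cvg; near=> n.
have n0 : n%:R != 0 :> R by rewrite pnatr_eq0 -lt0n; near: n; exact: nbhs_infty_gt.
have a0 : a.+1%:R != 0 :> R by rewrite pnatr_eq0.
have -> : bincoef a.+1 n = (n + a.+1)%:R * bincoef a n / a.+1%:R.
  by rewrite -bincoefSM; field; rewrite nat1r.
rewrite natrD exprS; field; rewrite ?nat1r a0 n0 expf_neq0 //.
Unshelve. all: by end_near.
Qed.

Lemma bincoef_geS a n : n.+1%:R <= bincoef a.+1 n.
Proof.
elim: n => [|n IH]; first by rewrite bincoef_n0.
rewrite bincoefS -addn1 natrD lerD // /bincoef ler1n bin_gt0; exact: leq_addl.
Qed.

(** Past the index from which [dl] is at most [eps * (1 - rho) / 2], the sequence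
[e] exceeds [eps / 2] by at most a geometric sequence of ratio [rho]. *)
Lemma contraction_cvg0 (rho : R) (e dl : nat -> R) :
  0 <= rho < 1 -> (forall n, 0 <= e n) ->
  (forall n, e n.+1 <= rho * e n + dl n) ->
  dl n @[n --> \oo] --> (0 : R) -> e n @[n --> \oo] --> (0 : R).
Proof.
move=> /andP[r0 r1] e0 he hd; apply/cvgrPdist_le => eps eps0.
have r1' : 0 < 1 - rho by rewrite subr_gt0.
have c0 : 0 < eps * (1 - rho) / 2 by rewrite divr_gt0 ?mulr_gt0.
have /cvgrPdist_le/(_ _ c0)[N _ hN] := hd.
have hb j : e (N + j)%N <= rho ^+ j * e N + eps / 2.
  elim: j => [|j IH]; first by rewrite addn0 expr0 mul1r lerDl divr_ge0 // ltW.
  have hdl : dl (N + j)%N <= eps * (1 - rho) / 2.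
    have := hN (N + j)%N (leq_addr _ _); rewrite /= sub0r normrN.
    exact: le_trans (ler_norm _).
  rewrite addnS; apply: le_trans (he _) _; rewrite exprS.
  have : rho * e (N + j)%N <= rho * (rho ^+ j * e N + eps / 2) by rewrite ler_wpM2l.
  by move=> ?; nra.
have h0 : (rho ^+ j * e N) @[j --> \oo] --> (0 : R).
  rewrite -(mul0r (e N)); apply: cvgM; last exact: cvg_cst.
  by apply: cvg_expr; rewrite ger0_norm.
have eps2 : 0 < eps / 2 by rewrite divr_gt0.
have /cvgrPdist_le/(_ _ eps2)[N1 _ hN1] := h0.
near=> n.
have hn : (N + N1 <= n)%N by near: n; exact: nbhs_infty_ge.
rewrite sub0r normrN ger0_norm //.
have -> : n = (N + (n - N))%N by rewrite subnKC // (leq_trans _ hn) ?leq_addr.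
apply: le_trans (hb _) _.
have hn' : (N1 <= n - N)%N by lia.
have := hN1 _ hn'; rewrite /= sub0r normrN ger0_norm; last by rewrite mulr_ge0 ?exprn_ge0.
by move=> ?; lra.
Unshelve. all: by end_near.
Qed.

(** With [L] the limit to be proved, the error [u n / bincoef a n - L] satisfies a
recurrence with the factor [rho * (bincoef a n / bincoef a n.+1)], which is at
most [rho], and a perturbation that tends to 0 because consecutive terms of the
scale are asymptotic to each other.  The case [rho = 0] says that a shift of the index
does not change the growth. *)
Lemma growth_rec (rho : R) u y a s :
  0 <= rho < 1 -> (forall n, u n.+1 = rho * u n + y n) ->
  growth y a s -> growth u a s.
Proof.
move=> /[dup] hr /andP[r0 r1] hu [C /andP[C0 Cs] hC].
have r1' : 0 < 1 - rho by rewrite subr_gt0.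
exists (C / (1 - rho)).
  rewrite divr_ge0 ?(ltW r1') //=; apply/implyP => /(implyP Cs) Cp.
  by rewrite divr_gt0.
set L := C / (1 - rho).
set r := fun n => bincoef a n / bincoef a n.+1.
(* What remains of [u n.+1 / bincoef a n.+1 - L] after [rho * r n] times the error. *)
set dl := fun n => r n * (y n / bincoef a n) - L + rho * r n * L.
have hdl : `|dl n| @[n --> \oo] --> (0 : R).
  rewrite -(normr0 R); apply: cvg_norm.
  have -> : 0 = 1 * C - L + rho * 1 * L :> R.
    by rewrite /L; field; rewrite gt_eqF.
  have hr1 : r n @[n --> \oo] --> (1 : R) by exact: bincoef_ratio.
  apply: cvgD.
    by apply: cvgB; [exact: cvgM|exact: cvg_cst].
  by apply: cvgM; [apply: cvgM => //; exact: cvg_cst|exact: cvg_cst].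
have he : `|u n / bincoef a n - L| @[n --> \oo] --> (0 : R).
  apply: (contraction_cvg0 hr _ _ hdl) => // n.
  have -> : u n.+1 / bincoef a n.+1 - L = rho * r n * (u n / bincoef a n - L) + dl n.
    by rewrite hu /dl /r; field; rewrite !bincoef_neq0.
  apply: le_trans (ler_normD _ _) _; rewrite lerD2r normrM normrM ger0_norm //.
  rewrite -mulrA ler_wpM2l // -[leRHS]mul1r ler_wpM2r //.
  have rn0 : 0 <= r n by apply: divr_ge0; apply: ltW; exact: bincoef_gt0.
  by rewrite ger0_norm // ler_pdivrMr ?bincoef_gt0 // mul1r ler_nat leq_bin2l.
have /norm_cvg0 h0 : `|u n / bincoef a n - L| @[n --> \oo] --> (0 : R^o) by exact: he.
have -> : (fun n => u n / bincoef a n) = (fun n => (u n / bincoef a n - L) + L).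
  by apply/funext => n; rewrite subrK.
by rewrite -[X in _ --> X]add0r; apply: cvgD => //; exact: cvg_cst.
Qed.

Lemma psumS u n : psum u n.+1 = psum u n + u n.+1.
Proof. by rewrite /psum big_ord_recr. Qed.

Lemma psum_bincoef a n : psum (bincoef a) n = bincoef a.+1 n.
Proof.
elim: n => [|n IH]; first by rewrite /psum big_ord1 !bincoef_n0.
by rewrite psumS IH bincoefS.
Qed.

(** A Cesaro argument: beyond some index the terms are at most [eps / 2] times the
scale, and the finitely many previous terms are absorbed because [bincoef a.+1]
is unbounded. *)
Lemma psum_small u a : u n / bincoef a n @[n --> \oo] --> (0 : R) ->
  psum u n / bincoef a.+1 n @[n --> \oo] --> (0 : R).
Proof.
move=> hu; apply/cvgrPdist_le => eps eps0.
have eps2 : 0 < eps / 2 by rewrite divr_gt0.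
have /cvgrPdist_le/(_ _ eps2)[N _ hN] := hu.
set K := `|psum u N|.
have hb j : `|psum u (N + j)| <= K + eps / 2 * bincoef a.+1 (N + j).
  elim: j => [|j IH].
    by rewrite addn0 lerDl mulr_ge0 ?bincoef_ge0 ?(ltW eps2).
  rewrite addnS psumS bincoefS mulrDr addrA.
  apply: le_trans (ler_normD _ _) _; apply: lerD => //.
  have := hN (N + j).+1; rewrite /= sub0r normrN normrM normfV.
  rewrite [`|bincoef _ _|]ger0_norm ?bincoef_ge0 // ler_pdivrMr ?bincoef_gt0 //.
  by apply; rewrite leqW ?leq_addr.
have hK : K * n%:R^-1 @[n --> \oo] --> (0 : R).
  rewrite -(mulr0 K); apply: cvgM; [exact: cvg_cst|exact: cvg_invn].
have /cvgrPdist_le/(_ _ eps2)[N1 _ hN1] := hK.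
near=> n.
have hn : (N <= n)%N by near: n; exact: nbhs_infty_ge.
have hn1 : (N1 <= n)%N by near: n; exact: nbhs_infty_ge.
have n0 : (0 < n)%N by near: n; exact: nbhs_infty_gt.
rewrite sub0r normrN normrM normfV [`|bincoef _ _|]ger0_norm ?bincoef_ge0 //.
rewrite ler_pdivrMr ?bincoef_gt0 //.
have := hb (n - N)%N; rewrite subnKC // => /le_trans; apply.
have := hN1 n hn1; rewrite /= sub0r normrN ger0_norm ?mulr_ge0 ?normr_ge0 //.
rewrite ler_pdivrMr ?ltr0n // => h1.
have h2 : n%:R <= bincoef a.+1 n by rewrite (le_trans _ (bincoef_geS a n)) // ler_nat.
have : eps / 2 * n%:R <= eps / 2 * bincoef a.+1 n by rewrite ler_wpM2l // ltW.
by move=> ?; lra.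
Unshelve. all: by end_near.
Qed.

Lemma growth_psum u a s : growth u a s -> growth (psum u) a.+1 s.
Proof.
move=> [C hC cC]; exists C => //.
have h : psum (fun j => u j - C * bincoef a j) n / bincoef a.+1 n
    @[n --> \oo] --> (0 : R).
  apply: psum_small.
  have -> : (fun n => (u n - C * bincoef a n) / bincoef a n) =
      (fun n => u n / bincoef a n - C).
    by apply/funext => n; field; rewrite bincoef_neq0.
  by rewrite -(subrr C); apply: cvgB => //; exact: cvg_cst.
have -> : (fun n => psum u n / bincoef a.+1 n) =
    (fun n => psum (fun j => u j - C * bincoef a j) n / bincoef a.+1 n + C).
  apply/funext => n; rewrite /psum sumrB -mulr_sumr -/(psum (bincoef a) n) psum_bincoef.
  by field; rewrite bincoef_neq0.
by rewrite -[X in _ --> X]add0r; apply: cvgD => //; exact: cvg_cst.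
Qed.

Lemma growth_flag u a s t : (t -> s) -> growth u a s -> growth u a t.
Proof.
move=> ts [C /andP[C0 Cs] cC]; exists C => //; rewrite C0 /=.
by apply/implyP => /ts; exact/implyP.
Qed.

Lemma growthD u v a s t :
  growth u a s -> growth v a t -> growth (fun n => u n + v n) a (s || t).
Proof.
move=> [C /andP[C0 Cs] cC] [D /andP[D0 Dt] cD]; exists (C + D).
  rewrite addr_ge0 //=; apply/implyP => /orP[/(implyP Cs)|/(implyP Dt)] h.
    exact: ltr_pwDl.
  exact: ltr_wpDl.
have -> : (fun n => (u n + v n) / bincoef a n) =
    (fun n => u n / bincoef a n + v n / bincoef a n) by apply/funext => n; rewrite mulrDl.
exact: cvgD.
Qed.

Lemma growth0 a : growth (fun=> 0) a false.
Proof.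
exists 0; first by rewrite lexx.
have -> : (fun n => 0 / bincoef a n) = (fun=> 0) by apply/funext => n; rewrite mul0r.
exact: cvg_cst.
Qed.

Lemma growth_sum (I : finType) (P : pred I) (F : I -> nat -> R) a (s : I -> bool) :
  (forall i, P i -> growth (F i) a (s i)) ->
  growth (fun n => \sum_(i | P i) F i n) a [exists (i | P i), s i].
Proof.
move=> hF.
have -> : [exists (i | P i), s i] = has s [seq i <- index_enum I | P i].
  apply/existsP/hasP => [[i /andP[Pi si]]|[i]].
    by exists i; rewrite // mem_filter Pi mem_index_enum.
  by rewrite mem_filter => /andP[Pi _] si; exists i; rewrite Pi.
elim: (index_enum I) => [|i r IH] /=.
  have -> : (fun n => \sum_(i <- [::] | P i) F i n) = (fun=> 0).
    by apply/funext => n; rewrite big_nil.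
  exact: growth0.
have -> : (fun n => \sum_(j <- i :: r | P j) F j n) =
    (fun n => (if P i then F i n else 0) + \sum_(j <- r | P j) F j n).
  by apply/funext => n; rewrite big_cons; case: ifP => // _; rewrite add0r.
case: ifP => Pi /=; first exact: growthD (hF _ Pi) IH.
by rewrite -[has _ _]orFb; apply: growthD IH; exact: growth0.
Qed.

Lemma growth_scale u a s c : 0 < c -> growth u a s ->
  growth (fun n => c * u n) a s.
Proof.
move=> c0 [C /andP[C0 Cs] cC]; exists (c * C).
  rewrite mulr_ge0 ?(ltW c0) //=; apply/implyP => /(implyP Cs) h.
  exact: mulr_gt0.
have -> : (fun n => c * u n / bincoef a n) = (fun n => c * (u n / bincoef a n)).
  by apply/funext => n; rewrite mulrA.
by apply: cvgM => //; exact: cvg_cst.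
Qed.

Lemma growth_cst1 : growth (fun=> 1) 0 true.
Proof.
exists 1; first by rewrite ler01 ltr01.
have -> : (fun n => 1 / bincoef 0 n) = (fun=> 1 : R).
  by apply/funext => n; rewrite bincoef0 divr1.
exact: cvg_cst.
Qed.

Lemma growthS u a s : growth u a s -> growth u a.+1 false.
Proof.
move=> [C _ cC]; exists 0; first by rewrite lexx.
have -> : (fun n => u n / bincoef a.+1 n) =
    (fun n => (u n / bincoef a n) * (a.+1%:R / (n + a.+1)%:R)).
  apply/funext => n.
  have a0 : a.+1%:R != 0 :> R by rewrite pnatr_eq0.
  have n0 : (n + a.+1)%:R != 0 :> R by rewrite pnatr_eq0 addnS.
  have -> : bincoef a.+1 n = (n + a.+1)%:R * bincoef a n / a.+1%:R.
    by rewrite -bincoefSM; field; rewrite nat1r.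
  move: n0 a0 (bincoef_neq0 a n).
  move: (n + a.+1)%:R a.+1%:R (bincoef a n) => x z b x0 z0 b0.
  by field; rewrite x0 z0 b0.
rewrite -(mulr0 C); apply: cvgM => //.
rewrite -(mulr0 a.+1%:R); apply: cvgM; first exact: cvg_cst.
by rewrite (cvg_shiftn a.+1 (fun n => n%:R^-1 : R)); exact: cvg_invn.
Qed.

Lemma growth_weak u a c s : (a <= c)%N -> growth u a s -> growth u c (s && (a == c)).
Proof.
elim: c => [|c IH]; first by rewrite leqn0 => /eqP ->; rewrite eqxx andbT.
rewrite leq_eqVlt => /orP[/eqP ->|]; first by rewrite eqxx andbT.
rewrite ltnS => ac hu.
rewrite (_ : a == c.+1 = false) ?andbF; first exact: growthS (IH ac hu).
by rewrite ltn_eqF.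
Qed.

Definition normalized q (f : nat -> nat) n : R := (f n)%:R / q%:R ^+ n.

(** The partial sums carry the exponent [m] even for [m = 0], where they converge.
For [m > 0] they do not determine the growth of the terms, which is therefore
recorded too; for [m = 0] the second part only says that the terms have a
nonnegative limit, since then [m.-1 = 0] and [bincoef 0] is constant. *)
Definition counts_growth q f m :=
  growth (psum (normalized q f)) m true /\ growth (normalized q f) m.-1 (0 < m)%N.

(** One vertex with [l] loops and successors [i] counted by [F i].  With
[g n = f n / q ^ n] and [h n] the contribution of the successors, both the terms
and the partial sums satisfy a recurrence with factor [l / q]:
[g n.+1 = (l / q) * g n + h n] and
[psum g n.+1 = (l / q) * psum g n + (1 + psum h n)].
For [l < q] these are contractions and the growth is inherited from [h].  For
[l = q] the first one telescopes, so that the terms of [g] grow like the partial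
sums of [h], and their sums gain one more order.  The summand 1, which is
[g 0], makes the limit positive when the maximum is 0. *)
Lemma growth_vertex (I : finType) (P : pred I) (F : I -> nat -> nat)
    (m : I -> nat) (f : nat -> nat) (l q : nat) :
  (0 < q)%N -> (l <= q)%N -> f 0 = 1%N ->
  (forall n, f n.+1 = l * f n + \sum_(i | P i) F i n)%N ->
  (forall i, P i -> counts_growth q (F i) (m i)) ->
  counts_growth q f ((l == q) + \max_(i | P i) m i).
Proof.
move=> q0 lq f0 fS hF; set M := \max_(i | P i) m i.
have qR : 0 < q%:R :> R by rewrite ltr0n.
have qn : q%:R != 0 :> R by rewrite gt_eqF.
have qi : 0 < (q%:R^-1 : R) by rewrite invr_gt0.
set g := normalized q f; set rho : R := l%:R / q%:R.
pose h n : R := q%:R^-1 * \sum_(i | P i) normalized q (F i) n.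
have gS n : g n.+1 = rho * g n + h n.
  rewrite /g /h /normalized fS natrD natrM -mulr_suml natr_sum /rho exprS.
  by field; rewrite expf_neq0 ?qn.
pose y n : R := 1 + psum h n.
have g0 : g 0%N = 1 by rewrite /g /normalized f0 expr0 divr1.
have GS n : psum g n.+1 = rho * psum g n + y n.
  rewrite {1}/psum big_ord_recl g0 /y addrCA; congr (_ + _).
  by rewrite /psum mulr_sumr -big_split /=; apply: eq_bigr => i _; exact: gS.
have hm i : P i -> (m i <= M)%N by move=> Pi; exact: leq_bigmax_cond.
have exM : (0 < M)%N -> [exists (i | P i), m i == M].
  move=> M0; have : (0 < #|P|)%N.
    rewrite lt0n; apply/negP => /eqP/card0_eq P0; move: M0.
    by rewrite /M big_pred0.
  case/(eq_bigmax_cond m) => i Pi Mi; apply/existsP; exists i.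
  by rewrite /M; apply/andP; split; [exact: Pi|apply/eqP/esym; exact: Mi].
have hy : growth y M true.
  have h1 := growth_weak (leq0n M) growth_cst1.
  have h2 : growth (fun n => \sum_(i | P i) psum (normalized q (F i)) n) M
      [exists (i | P i), m i == M].
    apply: (growth_sum (s := fun i => m i == M)) => i Pi.
    exact: (growth_weak (hm i Pi) (hF i Pi).1).
  have := growthD h1 (growth_scale qi h2).
  rewrite (_ : (fun n => _) = y); last first.
    apply/funext => n; rewrite /y /psum /h; congr (_ + _).
    by rewrite -mulr_sumr exchange_big.
  apply: growth_flag => _ /=.
  by case: (posnP M) => [M0|/exM ->]; rewrite ?orbT // M0 eqxx.
have [lq'|/negbTE lq'] := eqVneq l q; last first.
  have hrho : 0 <= rho < 1.
    rewrite divr_ge0 ?ler0n //= ltr_pdivrMr // mul1r ltr_nat ltn_neqAle lq.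
    by rewrite lq'.
  split; first exact: growth_rec hrho GS hy.
  apply: (growth_rec hrho gS).
  have h2 : growth (fun n => \sum_(i | P i) normalized q (F i) n) M.-1
      [exists (i | P i), (0 < m i)%N && ((m i).-1 == M.-1)].
    apply: (growth_sum (s := fun i => (0 < m i)%N && ((m i).-1 == M.-1))) => i Pi.
    apply: growth_weak (hF i Pi).2.
    by rewrite -!subn1 leq_sub2r ?hm.
  apply: growth_flag (growth_scale qi h2) => M0.
  have /existsP[i /andP[Pi /eqP mi]] := exM M0.
  by apply/existsP; exists i; rewrite Pi mi M0 eqxx.
rewrite add1n.
have hg : growth g M true.
  apply: (growth_rec (rho := 0) _ _ hy); first by rewrite lexx ltr01.
  have rho1 : rho = 1 by rewrite /rho lq' divff.
  move=> n; rewrite mul0r add0r; elim: n => [|n IH].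
    by rewrite gS rho1 mul1r g0 /y /psum big_ord1.
  by rewrite gS rho1 mul1r IH /y psumS addrA.
by split => //; exact: growth_psum.
Qed.

Lemma counts_growth_asymp q f M : (0 < q)%N -> counts_growth q f M.+1 ->
  exists2 C : R, 0 < C &
    asymp_equiv (fun n => (f n)%:R) (fun n => C * n%:R ^+ M * q%:R ^+ n).
Proof.
move=> q0 [_ [C /andP[_ /= C0] hC]]; exists (C / M`!%:R).
  by rewrite divr_gt0 // ltr0n fact_gt0.
have Cn : C != 0 by rewrite gt_eqF.
have Fn : M`!%:R != 0 :> R by rewrite pnatr_eq0 -lt0n fact_gt0.
have qn : q%:R != 0 :> R by rewrite pnatr_eq0 -lt0n.
rewrite /asymp_equiv.
have h : normalized q f n / bincoef M n * (bincoef M n / n%:R ^+ M) * (M`!%:R / C)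
    @[n --> \oo] --> (C * M`!%:R^-1 * (M`!%:R / C) : R).
  by apply: cvgM; [apply: cvgM => //; exact: bincoef_pow|exact: cvg_cst].
rewrite (_ : C * M`!%:R^-1 * (M`!%:R / C) = 1) in h; last by field; rewrite Cn Fn.
apply: cvg_trans h; apply: near_eq_cvg; near=> n.
have n0 : n%:R != 0 :> R by rewrite pnatr_eq0 -lt0n; near: n; exact: nbhs_infty_gt.
rewrite [X in _ && X](_ : _ = false) ?andbF.
  by rewrite /normalized; field; rewrite bincoef_neq0 Cn Fn !expf_neq0.
by apply/negbTE; rewrite !mulf_neq0 ?invr_neq0 ?expf_neq0.
Unshelve. all: by end_near.
Qed.
End Growth.

(** * The automaton of a pattern *)

(** The maximum over the simple paths and the order of growth obey the same
recursion over the exits of [v], which have a smaller measure. *)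
Lemma vertex_growth (R : realType) p k (v : word k) :
  p != [::] -> avoids p v ->
  exists2 m, max_from p (size (undup p)).-1 v m &
    (0 < (size (undup p)).-1)%N -> counts_growth R (size (undup p)).-1 (num_ext p v) m.
Proof.
move=> p0; have [N] := ubnP (missing_subwords p v); elim: N v => // N IH v hN av.
set q := (size (undup p)).-1.
pose good i m := exits p v i -> max_from p q (rcons v i) m /\
  ((0 < q)%N -> counts_growth R q (num_ext p (rcons v i)) m).
have [m hm] : {m & forall i, good i (m i)}.
  apply: (choice (P := good)) => i.
  have [hi|nhi] := boolP (exits p v i); last by exists 0%N => /(negP nhi).
  have /andP[/asboolPn nl ai] := hi.
  have [m h1 h2] := IH (rcons v i) (leq_trans (missing_subwords_rcons nl) hN) ai.
  by exists m.
exists ((#|is_loop p v| == q) + \max_(i | exits p v i) m i)%N.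
  by apply: max_from_step => // i /hm[].
move=> q0; apply: growth_vertex => //.
- by have := num_loops_lt p0 av; rewrite /q; case: (size _).
- exact: num_ext0.
- exact: num_ext_step.
- by move=> i /hm[_]; exact.
Qed.

(** Words over [A] avoid [p], having too few letters.  Reading letters of [A] that
change the class ends by the measure, at a state where all of them are loops;
there are no further loops by [num_loops_lt]. *)
Lemma full_state_exists p k (v : word k) (A : pred 'I_k) :
  p != [::] -> #|A| = (size (undup p)).-1 -> all (mem A) v ->
  exists2 e, simple_from p v e &
    (0 < num_states_from p (size (undup p)).-1 (word_class p v) e)%N.
Proof.
move=> p0 cA; have d0 := size_undup_gt0 p0.
have [N] := ubnP (missing_subwords p v); elim: N v => // N IH v hN vA.
have av : avoids p v by apply: avoids_few vA _; rewrite cA ltn_predL.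
have [/forallP hA|] := boolP [forall i, A i ==> is_loop p v i].
  exists [::]; first exact: simple_from_nil.
  rewrite num_states_from_nil eqn_leq -{2}cA.
  have -> : (#|A| <= #|is_loop p v|)%N.
    by apply/subset_leq_card/fintype.subsetP => i; apply/implyP/hA.
  by have := num_loops_lt p0 av; case: (size _) d0 => // d _; rewrite ltnS => ->.
rewrite negb_forall => /existsP[i]; rewrite negb_imply => /andP[Ai /asboolPn nl].
have viA : all (mem A) (rcons v i) by rewrite all_rcons vA andbT.
have [e he h0] := IH _ (leq_trans (missing_subwords_rcons nl) hN) viA.
exists ((i, word_class p (rcons v i)) :: e); first exact/simple_from_cons.
by have [hp _ _] := he; rewrite num_states_from_cons // addn_gt0 h0 orbT.
Qed.

Theorem theorem3p2 (R : realType) (p : seq nat) (d k : nat)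
    (hp : is_pattern p) (hd : size (undup p) = d)
    (hk0 : (0 < k)%N) (hk : (d - 1 <= k)%N) :
  exists (M : nat) (C : R),
    [/\ max_states_with_loops p k (d - 1) M.+1,
        0 < C &
        asymp_equiv (fun n => (num_avoiding p k n)%:R)
                    (fun n => C * n%:R ^+ M * (d - 1)%:R ^+ n)].
Proof.
have /andP[p0 _] := hp; rewrite subn1 in hk *; subst d.
have ae : avoids p ([::] : word k).
  apply/negP => /containsP[u]; rewrite subseq0 => /eqP -> [].
  by move/esym/eqP; rewrite size_eq0 (negbTE p0).
have [m hm hcount] := vertex_growth R p0 ae.
(* The alphabet of [full_state_exists]: the [d - 1] smallest letters. *)
have hA : #|[pred i | i \in codom (widen_ord hk)]| = (size (undup p)).-1.
  rewrite -[RHS]card_ord -(card_codom (f := widen_ord hk)) //.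
  by move=> i j /(congr1 val) /= /val_inj.
have [e he h0] := full_state_exists p0 hA (isT : all (mem _) [::]).
have m0 : (0 < m)%N := leq_trans h0 (hm.2 e he).
have [q0|q0] := posnP (size (undup p)).-1.
  exists m.-1, 1; split => //; first by rewrite prednK.
  have d1 : size (undup p) = 1%N.
    have := num_loops_lt p0 ae; move: q0.
    by case: (size _) => // -[].
  have cvg1 : (fun=> 1 : R) n @[n --> \oo] --> (1 : R) by exact: cvg_cst.
  rewrite /asymp_equiv; apply: cvg_trans cvg1; apply: near_eq_cvg; near=> n.
  have hn : (missing_subwords p ([::] : word k) < n)%N by near: n; exact: nbhs_infty_gt.
  have := num_ext_loopless p0 d1 hn; rewrite /num_ext /num_avoiding => ->.
  by rewrite q0 expr0n gtn_eqF ?(leq_trans _ hn) // mulr0 eqxx.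
have hc : counts_growth R (size (undup p)).-1 (num_ext p ([::] : word k)) m.-1.+1.
  by rewrite prednK //; exact: hcount.
have [C C0 hC] := counts_growth_asymp q0 hc.
by exists m.-1, C; split => //; rewrite prednK.
Unshelve. all: by end_near.
Qed.
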